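(* Let $\mathscr{A}$ be the set of all unique representation bases $A\subseteq\mathbb{Z}$ for which there exists a real number $c>0$ such that $A(-x,x)>c\sqrt{x}$ for infinitely many positive integers $x$. For $A\in\mathscr{A}$ put $$c_A:=\limsup_{x\to\infty}\frac{A(-x,x)}{\sqrt{x}},\qquad c_{\mathscr{A}}:=\sup_{A\in\mathscr{A}}c_A .$$ Then $c_{\mathscr{A}}\ge 1$.
   Context: For $A\subseteq\mathbb{Z}$ and $n\in\mathbb{Z}$, let $r_A(n)=\#\{(a,a'): n=a+a',\ a\le a',\ a,a'\in A\}$. A set $A\subseteq\mathbb{Z}$ is called a unique representation basis (for the integers) if $r_A(n)=1$ for every $n\in\mathbb{Z}$. For $x>0$, $A(-x,x):=|A\cap[-x,x]|$. *)

(* Defs.v *)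
From mathcomp Require Import all_boot all_order all_algebra.
From mathcomp Require Import finmap.
From mathcomp Require Import all_classical all_reals all_analysis.

Set Implicit Arguments.
Unset Strict Implicit.
Unset Printing Implicit Defensive.

Import Order.TTheory GRing.Theory Num.Theory.
Import numFieldNormedType.Exports.

Local Open Scope classical_set_scope.
Local Open Scope ring_scope.
Local Open Scope card_scope.

(* r_A(n) is the cardinality of this set. *)
Definition reps (A : set int) (n : int) : set (int * int) :=
  [set p | [/\ A p.1, A p.2, p.1 <= p.2 & n = p.1 + p.2]].

(* `#=` is equipotence and `I_1 = {0}, so this says r_A(n) = 1 for all n,
   with no prior assumption that r_A(n) is finite. *)
Definition unique_rep_basis (A : set int) : Prop :=
  forall n : int, reps A n #= `I_1.

(* A(-x, x) = |A `&` [-x, x]|; fset_set maps infinite sets to fset0, but this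
   set is always finite. *)
Definition counting_fun (R : realType) (A : set int) (x : R) : nat :=
  #|` fset_set [set a : int | A a /\ (- x <= a%:~R <= x)]|%fset.

Definition dense_unique_rep_bases (R : realType) : set (set int) :=
  [set A | unique_rep_basis A /\
    exists2 c : R, 0 < c &
      infinite_set [set x : nat |
        (0 < x)%N /\ c * Num.sqrt x%:R < (counting_fun A (x%:R : R))%:R]].

Definition c_of (R : realType) (A : set int) : \bar R :=
  limf_esup (fun x : R => ((counting_fun A x)%:R / Num.sqrt x)%:E) +oo%R.

(* The supremum is taken in \bar R, where the empty set has supremum -oo. *)
Definition c_sup (R : realType) : \bar R :=
  ereal_sup [set c_of R A | A in dense_unique_rep_bases R].

(* Main.v *)
(* A Sidon set of integers in which every integer is a sum of two elements is a
   unique representation basis. Such a set is the union of an increasing chain of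
   finite Sidon sets, extended in turn in two ways.
   To represent n, add u and n - u with u huge.
   To be dense at N = p (p - 1), with p a prime large compared to the current set A
   contained in [-M, M], take Ruzsa's Sidon set of p - 1 residues modulo N, represented
   in [-N, -N/2) and [N/2, N), and discard the O(M) elements within O(M) of an endpoint
   or having a sum or a difference with another element in [-2M, 2M]. The remaining
   p - O(M) elements may be added to A, and p - O(M) is asymptotic to sqrt N. *)
Require Import Defs.
From mathcomp Require Import all_boot all_order all_algebra.
From mathcomp Require Import cyclic finfield zify lra ring.
From mathcomp Require Import all_classical all_reals all_analysis.

Set Implicit Arguments.
Unset Strict Implicit.
Unset Printing Implicit Defensive.

Import Order.TTheory GRing.Theory Num.Theory.

Local Open Scope ring_scope.

(** * Ruzsa's Sidon set modulo [p (p - 1)] *)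

(** By Fermat the [p - 1] nonzero elements are all roots of [X ^ (p - 1) - 1], and that many roots
    in a field include a primitive one. *)
Lemma Fp_prim_root (p : nat) : prime p -> exists z : 'F_p, p.-1.-primitive_root z.
Proof.
move=> pp; pose rs := [seq x <- enum 'F_p | x != 0].
suff /hasP[z _ hz] : has p.-1.-primitive_root rs by exists z.
apply: has_prim_root.
- by have := prime_gt1 pp; lia.
- apply/allP => x; rewrite mem_filter => /andP[x0 _].
  rewrite unity_rootE; apply/eqP; apply: (mulfI x0).
  rewrite mulr1 -exprS prednK ?prime_gt0 //.
  by have := expf_card x; rewrite card_Fp.
- exact/filter_uniq/enum_uniq.
- have -> : size rs = #|[pred x : 'F_p | x != 0]|.
    by rewrite cardE /rs enumT /enum_mem -enumT; congr size; apply: eq_filter.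
  have := cardC1 (0 : 'F_p); rewrite card_Fp // => h.
  by rewrite -h; apply/eq_leq/eq_card.
Qed.

(** Both pairs are the roots, with multiplicity, of the monic quadratic with this sum and
    product. *)
Lemma sum_prod_eq (F : idomainType) (x y z t : F) :
  x + y = z + t -> x * y = z * t -> (x = z /\ y = t) \/ (x = t /\ y = z).
Proof.
move=> hs hp.
have : (x - z) * (x - t) = 0.
  have -> : (x - z) * (x - t) = x * x - x * (z + t) + z * t by ring.
  by rewrite -hs -hp; ring.
move/eqP; rewrite mulf_eq0 !subr_eq0 => /orP[] /eqP xE; subst x;
  [left|right]; split=> //.
  exact: addrI hs.
by move: hs; rewrite [z + t]addrC => /addrI.
Qed.

(* Ruzsa's construction: r_i is congruent to i mod p - 1 and to g ^ i mod p, g a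
   primitive root. A congruence of sums modulo p (p - 1) fixes both the sum and
   the product of the two powers of g. *)
Lemma ruzsa_sidon (p : nat) : prime p -> exists r : 'I_p.-1 -> nat,
  forall i j k l, r i + r j = r k + r l %[mod p.-1 * p] ->
    (i = k /\ j = l) \/ (i = l /\ j = k).
Proof.
move=> pp; have [g hg] := Fp_prim_root pp.
have p1 : (0 < p.-1)%N by have := prime_gt1 pp; lia.
have cop : coprime p.-1 p by rewrite coprimePn ?prime_gt0.
pose r (i : 'I_p.-1) := chinese p.-1 p i (g ^+ i : 'F_p).
exists r => i j k l /eqP.
rewrite chinese_remainder // => /andP[/eqP h1 /eqP h2].
have r1 i' : r i' = i' %[mod p.-1] by rewrite /r chinese_modl.
have r2 i' : (r i')%:R = g ^+ i' :> 'F_p.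
  apply: val_inj => /=.
  rewrite val_Fp_nat // /r chinese_modr //.
  by rewrite modn_small // -[ltnRHS](Fp_cast pp) ltn_ord.
have gi (a b : 'I_p.-1) : g ^+ a = g ^+ b -> a = b.
  by move/eqP; rewrite (eq_prim_root_expr hg) !modn_small ?ltn_ord // => /eqP/val_inj.
have hs : g ^+ i + g ^+ j = g ^+ k + g ^+ l.
  rewrite -!r2 -!natrD; apply: val_inj => /=.
  by rewrite !val_Fp_nat.
have hp : g ^+ i * g ^+ j = g ^+ k * g ^+ l.
  rewrite -!exprD; apply/eqP; rewrite (eq_prim_root_expr hg).
  by rewrite -modnDm -!r1 modnDm h1 -modnDm !r1 modnDm.
by case: (sum_prod_eq hs hp) => -[/gi-> /gi->]; [left|right].
Qed.

(** Concluding on indices rather than on values makes [b] injective as well. *)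
Definition indexed_sidon (I : Type) (b : I -> int) : Prop :=
  forall i j k l, b i + b j = b k + b l ->
    (i = k /\ j = l) \/ (i = l /\ j = k).

(* The representatives modulo p (p - 1) = 2 H are taken in [-2H, -H) and [H, 2H),
   so that sums of two of them stay away from both ranges, up to the boundary. *)
Lemma ruzsa_sidon_centered (p : nat) : prime p ->
  exists (H : nat) (b : 'I_p.-1 -> int), [/\ (p.-1 * p = 2 * H)%N,
  forall i, H%:Z <= `|b i| <= 2 * H%:Z &
  indexed_sidon b].
Proof.
move=> pp; have [r hr] := ruzsa_sidon pp.
have [H hH] : exists H, (p.-1 * p = 2 * H)%N.
  exists (p.-1 * p)./2; rewrite mul2n even_halfK // oddM.
  by case: p pp {r hr} => //= n _; case: (odd n).
have N0 : (0 < p.-1 * p)%N by rewrite muln_gt0; have := prime_gt1 pp; lia.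
pose q i := (r i %% (p.-1 * p))%N.
have qN i : (q i < 2 * H)%N by rewrite -hH ltn_pmod.
pose b i : int := if (H <= q i)%N then (q i)%:Z else (q i)%:Z - 2 * H%:Z.
exists H, b; split=> // [i|i j k l e].
  by have := qN i; rewrite /b; case: ifP; lia.
apply: hr; rewrite -modnDm -[in RHS]modnDm -!/(q _) hH.
have [t ht] : exists t : int, (q i + q j)%:Z = (q k + q l)%:Z + t * (2 * H)%:Z.
  move: e; rewrite /b.
  (* Each index with [q < H] was shifted down by [2H]; the witness is the net number of shifts. *)
  exists ((H > q i)%N%:Z + (H > q j)%N%:Z - (H > q k)%N%:Z - (H > q l)%N%:Z).
  by move: e; do 4![case: ifP => ?]; lia.
by apply/eqP; rewrite -eqz_nat -!modz_nat ht addrC modzMDl.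
Qed.

(** * Pruning a Sidon family by counting conflicts *)

Lemma cards_bigcup_le (I J : finType) (F : I -> {set J}) (c : nat) :
  (forall i, #|F i| <= c)%N -> (#|(\bigcup_i F i)%SET| <= #|I| * c)%N.
Proof.
move=> h; have -> : (#|I| * c = \sum_(i : I) c)%N by rewrite sum_nat_const.
apply: (@leq_trans (\sum_i #|F i|)%N); last exact: leq_sum.
elim/big_ind2: _ => [|A m B n hA hB|//]; first by rewrite cards0.
by rewrite (leq_trans _ (leq_add hA hB)) // cardsU leq_subr.
Qed.

Lemma card_fiber_le1 (I : finType) (b : I -> int) (t : int) : injective b ->
  (#|[set i | b i == t]| <= 1)%N.
Proof.
move=> bI; apply/card_le1_eqP => i j; rewrite !inE => /eqP hi /eqP hj.
by apply: bI; rewrite hi hj.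
Qed.

Lemma indexed_sidon_inj (I : Type) (b : I -> int) : indexed_sidon b -> injective b.
Proof. by move=> bS i j e; case: (bS i i j j); rewrite ?e // => -[]. Qed.

Lemma card_sum_fiber_le2 (I : finType) (b : I -> int) (t : int) : indexed_sidon b ->
  (#|[set i | [exists j, (b i + b j == t)%R]]| <= 2)%N.
Proof.
move=> bS; have [->|[i]] := set_0Vmem [set i | [exists j, (b i + b j == t)%R]].
  by rewrite cards0.
rewrite inE => /existsP[j /eqP e].
apply: (@leq_trans #|[set i; j]|); last by rewrite cards2; case: (_ != _).
apply/subset_leq_card/fintype.subsetP => k; rewrite !inE => /existsP[l /eqP e'].
by case: (bS _ _ _ _ (etrans e' (esym e))) => -[-> _]; rewrite eqxx ?orbT.
Qed.

(** Written as [b i + b l = b k + b j], two equal differences force [i = k], since [i = j] is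
    excluded. *)
Lemma card_diff_fiber_le1 (I : finType) (b : I -> int) (t : int) : indexed_sidon b ->
  (#|[set i | [exists j, (j != i) && (b i - b j == t)%R]]| <= 1)%N.
Proof.
move=> bS; apply/card_le1_eqP => i k; rewrite !inE.
move=> /existsP[j /andP[ji /eqP e]] /existsP[l /andP[lk /eqP e']].
by case: (bS i l k j) => [|[]|[ij]]; [lia| |rewrite ij eqxx in ji].
Qed.

(** [D] collects the conflicts at the [8M + 1] offsets in [[-4M, 4M]]. Each offset costs at most 7
    indices: one near each of [H], [-H], [2H], [-2H], two for sums and one for differences. *)
Lemma indexed_sidon_prune (I : finType) (b : I -> int) (H M : nat) : indexed_sidon b ->
  exists2 D : {set I},
  (#|D| <= (8 * M + 1) * 7)%N &
  [/\ forall i, i \notin D -> H%:Z <= `|b i| <= 2 * H%:Z ->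
        H%:Z + 2 * M%:Z < `|b i| < 2 * H%:Z - 2 * M%:Z,
      forall i j, i \notin D -> 2 * M%:Z < `|b i + b j| &
      forall i j, i \notin D -> j != i -> 2 * M%:Z < `|b i - b j| ].
Proof.
move=> bS; pose t (m : 'I_(8 * M + 1)) : int := m%:Z - 4 * M%:Z.
pose F m := [set i | b i == H%:Z + t m] :|: [set i | b i == - H%:Z + t m] :|:
  [set i | b i == 2 * H%:Z + t m] :|: [set i | b i == - (2 * H%:Z) + t m] :|:
  [set i | [exists j, b i + b j == t m]] :|:
  [set i | [exists j, (j != i) && (b i - b j == t m)]].
have inF i (m : int) : i \notin (\bigcup_m F m)%SET -> `|m| <= 4 * M%:Z ->
   [/\ b i != H%:Z + m, b i != - H%:Z + m, b i != 2 * H%:Z + m, b i != - (2 * H%:Z) + m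
     & (forall j, b i + b j != m) /\ (forall j, j != i -> b i - b j != m)].
  move=> hi hm.
  have hm' : (absz (m + 4 * M%:Z)%R < 8 * M + 1)%N by lia.
  have tE : t (Ordinal hm') = m by rewrite /t /=; lia.
  have : i \notin F (Ordinal hm').
    by apply: contra hi => hi; apply/bigcupP; exists (Ordinal hm').
  rewrite /F !inE tE !negb_or -!andbA => /and5P[-> -> -> ->].
  move=> /andP[h1 h2]; split=> //; split.
    by move=> j; apply: contra h1 => h1; apply/existsP; exists j.
  by move=> j ji; apply: contra h2 => h2; apply/existsP; exists j; rewrite ji.
exists (\bigcup_m F m)%SET.
  rewrite -[X in (X * 7)%N](card_ord (8 * M + 1)); apply: cards_bigcup_le => m.
  have bI := indexed_sidon_inj bS.
  have cU (X Y : {set I}) x y : (#|X| <= x -> #|Y| <= y -> #|X :|: Y| <= x + y)%N.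
    by move=> hX hY; rewrite (leq_trans _ (leq_add hX hY)) // cardsU leq_subr.
  have h c := card_fiber_le1 c bI.
  by have := cU _ _ _ _ (cU _ _ _ _ (cU _ _ _ _ (cU _ _ _ _
      (cU _ _ _ _ (h (H%:Z + t m)) (h (- H%:Z + t m)))
    (h (2 * H%:Z + t m))) (h (- (2 * H%:Z) + t m))) (card_sum_fiber_le2 (t m) bS))
    (card_diff_fiber_le1 (t m) bS).
split=> [i hi hH|i j hi|i j hi ji].
- have h := inF i _ hi.
  have [] := (h (b i - H%:Z), h (b i + H%:Z), h (b i - 2 * H%:Z), h (b i + 2 * H%:Z)).
  move=> [[h1 h2] h3] h4.
  have := (ltP (4 * M%:Z) `|b i - H%:Z|, ltP (4 * M%:Z) `|b i + H%:Z|,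
    ltP (4 * M%:Z) `|b i - 2 * H%:Z|, ltP (4 * M%:Z) `|b i + 2 * H%:Z|).
  case=> [[[[g1|/h1[]]]]]; try lia; case=> [g2|/h2[]]; try lia;
   case=> [g3|/h3[]]; try lia; case=> [g4|/h4[]]; lia.
- rewrite ltNge; apply/negP => hle.
  have [|_ _ _ _ [/(_ j)]] := inF i (b i + b j) hi; first lia.
  by rewrite eqxx.
- rewrite ltNge; apply/negP => hle.
  have [|_ _ _ _ [_ /(_ j ji)]] := inF i (b i - b j) hi; first lia.
  by rewrite eqxx.
Qed.

Local Open Scope classical_set_scope.

(** * The two extensions of a bounded Sidon set *)

Definition sidon (A : set int) : Prop :=
  forall a b c d, A a -> A b -> A c -> A d -> a + b = c + d ->
    (a = c /\ b = d) \/ (a = d /\ b = c).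

Definition bounded_by (A : set int) (M : int) : Prop :=
  forall a, A a -> `|a| <= M.

(** Absolute values tell the kinds of sums apart: at most [2M] in [A + A]; between [H + M] and
    [2H - M] in [A + B]; in [B + B], above [2H + 4M] for equal signs, between [2M] and [H - 4M] for
    opposite signs. Within [A + B], distinct elements of [B] differ by more than two elements of [A]
    can. *)
Lemma sidon_setU (A B : set int) (M H : int) :
  sidon A -> sidon B -> bounded_by A M ->
  (forall b, B b -> H + 2 * M < `|b| < 2 * H - 2 * M) ->
  (forall b b', B b -> B b' -> 2 * M < `|b + b'|) ->
  (forall b b', B b -> B b' -> b != b' -> 2 * M < `|b - b'|) ->
  sidon (A `|` B).
Proof.
move=> sA sB bA hB hp hm a b c d.
case=> [Aa|Ba]; case=> [Ab|Bb]; case=> [Ac|Bc]; case=> [Ad|Bd] e;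
  try (by apply: sA); try (by apply: sB);
  repeat match goal with
  | h : A ?x |- _ => move: (bA _ h); clear h
  end;
  repeat match goal with
  | h : B ?x, h' : B ?y |- _ =>
    lazymatch x with y => fail | _ => idtac end;
    move: (hp _ _ h h') (hm _ _ h h') (hB _ h) (hB _ h'); clear h h'
  | h : B ?x |- _ => move: (hB _ h) ; clear h
  end; try lia.
Qed.

(** As [u] dwarfs [M] and [n], equal sums contain the same net multiple of [u]. The only new
    coincidence would be [u + (n - u) = a + b] with [a], [b] in [A], which is excluded. *)
Lemma sidon_setU_pair (A : set int) (M n : int) :
  0 <= M -> sidon A -> bounded_by A M -> (forall a b, A a -> A b -> a + b <> n) ->
  let u := 10 * M + 10 * `|n| + 10 in
  sidon (A `|` [set u; n - u]).
Proof.
move=> M0 sA bA hn u a b c d hA hB hC hD e.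
have K x : (A `|` [set u; n - u]) x -> (A x /\ `|x| <= M) \/ x = u \/ x = n - u.
  by case=> [Ax|[->|->]]; [left; split=> //; exact: bA|right; left|right; right].
have nuE : exists v, v = `|n| by eexists.
case: nuE => v vE.
have [v0 [nv1 nv2]] : 0 <= v /\ n <= v /\ - v <= n by lia.
have uE : u = 10 * M + 10 * v + 10 by rewrite vE.
move: u uE K hA hB hC hD {vE} => u uE K.
move=> /K + /K + /K + /K.
case=> [[Aa ha]|[aE|aE]]; case=> [[Ab hb]|[bE|bE]]; case=> [[Ac hc]|[cE|cE]];
  case=> [[Ad hd]|[dE|dE]]; first [by apply: sA
  | lia
  | by case: (hn a b Aa Ab); lia | by case: (hn c d Ac Ad); lia].
Qed.

(* As x <= p ^ 2, at least k / (k + 1) * sqrt x elements of A lie in [-x, x]. *)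
Definition dense_at (A : set int) (k : nat) : Prop :=
  exists (x p : nat) (s : seq int),
    [/\ (0 < x)%N, (k <= x <= p ^ 2)%N, (k * p <= k.+1 * size s)%N, uniq s &
        forall a, a \in s -> A a /\ `|a| <= x%:Z].

Lemma dense_atS (A B : set int) (k : nat) : A `<=` B -> dense_at A k -> dense_at B k.
Proof.
move=> AB [x [p [s [x0 kx kp us h]]]]; exists x, p, s; split=> // a /h[Aa ?].
by split=> //; exact: AB.
Qed.

Definition bounded_sidon (A : set int) : Prop :=
  sidon A /\ exists M : nat, bounded_by A M%:Z.

Lemma bounded_by_setU (A B : set int) (M N : nat) :
  bounded_by A M%:Z -> bounded_by B N%:Z -> bounded_by (A `|` B) (M + N)%:Z.
Proof. by move=> hA hB x [/hA|/hB]; lia. Qed.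

Lemma bounded_sidon_dense (A : set int) (k : nat) : bounded_sidon A ->
  exists A', [/\ A `<=` A', bounded_sidon A' & dense_at A' k].
Proof.
move=> [sA [M bA]].
pose C := ((8 * M + 1) * 7)%N.
(* At least [p - 1 - C] elements survive pruning, and [p >= (k + 1)(C + 1)] makes this at least
   [k p / (k + 1)]. The extra [k] gives [k <= p (p - 1)]. *)
have [p hp pp] := prime_above (k.+1 * C.+1 + k)%N.
have [H [b [HE bH bS]]] := ruzsa_sidon_centered pp.
have [D hD [D1 D2 D3]] := indexed_sidon_prune H M bS.
pose B : set int := [set x | exists2 i, i \notin D & x = b i].
have bI := indexed_sidon_inj bS.
exists (A `|` B); split; first exact: subsetUl.
- split; last first.
    exists (M + 2 * H)%N; apply: bounded_by_setU => // _ [i _ ->].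
    by have := bH i; lia.
  apply: (@sidon_setU _ _ M%:Z H%:Z) => //.
  + move=> _ _ _ _ [i _ ->] [j _ ->] [i' _ ->] [j' _ ->] /bS.
    by case=> -[-> ->]; [left|right].
  + by move=> _ [i hi ->]; exact: D1.
  + by move=> _ _ [i hi ->] [j hj ->]; exact: D2.
  + move=> _ _ [i hi ->] [j hj ->] ij; apply: D3 => //.
    by apply: contra_neq ij => ->.
- exists (p.-1 * p)%N, p, (map b (enum (~: D)%SET)).
  have p1 := prime_gt1 pp.
  split.
  + by rewrite muln_gt0; lia.
  + by apply/andP; split; nia.
  + have := cardsC D; rewrite card_ord size_map -cardE => hc.
    have h1 : (p <= #|~: D|%SET + C.+1)%N by rewrite /C; lia.
    have h2 := leq_mul (leqnn k.+1) h1.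
    by rewrite mulnDr in h2; lia.
  + by rewrite map_inj_uniq // enum_uniq.
  + move=> _ /mapP[i hi ->]; split; last by have := bH i; rewrite HE; lia.
    by right; exists i => //; move: hi; rewrite mem_enum inE.
Qed.

Lemma bounded_sidon_rep (A : set int) (n : int) : bounded_sidon A ->
  exists A', [/\ A `<=` A', bounded_sidon A' & exists a b, [/\ A' a, A' b & n = a + b]].
Proof.
move=> [sA [M bA]].
have [[a [b [Aa Ab ab]]]|no] := pselect (exists a b, [/\ A a, A b & n = a + b]).
  by exists A; split=> //; [split=> //; exists M|exists a, b].
set u := 10 * M%:Z + 10 * `|n| + 10.
exists (A `|` [set u; n - u]); split; first exact: subsetUl.
- split.
    apply: sidon_setU_pair => // a b Aa Ab ab; apply: no.
    by exists a, b.
  exists (M + (`|u| + `|n - u|))%N; apply: bounded_by_setU => // x.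
  by case=> ->; lia.
- by exists u, (n - u); split; [right; left|right; right|lia].
Qed.

Lemma bounded_sidon_step (A : set int) (k : nat) (n : int) : bounded_sidon A ->
  exists A', [/\ A `<=` A', bounded_sidon A', dense_at A' k &
                 exists a b, [/\ A' a, A' b & n = a + b]].
Proof.
move=> /(bounded_sidon_dense k)[A1 [s1 b1 d1]].
have [A2 [s2 b2 r2]] := bounded_sidon_rep n b1.
by exists A2; split=> //; [exact: subset_trans s2|exact: dense_atS d1].
Qed.

(** * The union of the chain is a dense unique representation basis *)

Lemma exists_dense_sidon_basis : exists A : set int,
  [/\ sidon A, (forall n, exists a b, [/\ A a, A b & n = a + b]) &
      forall k, dense_at A k].
Proof.
(* Stage [k] secures density at [k] and represents the integer with code [k], or 0 if [k] is no
   code. *)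
have step (x : {A | bounded_sidon A} * nat) : exists y : {A | bounded_sidon A},
    [/\ sval x.1 `<=` sval y, dense_at (sval y) x.2 &
        exists a b, [/\ sval y a, sval y b & odflt 0 (unpickle x.2) = a + b]].
  have [A' [h1 h2 h3 h4]] := bounded_sidon_step x.2 (odflt 0 (unpickle x.2)) (svalP x.1).
  by exists (exist _ A' h2); split.
have [f hf] := choice step.
have b0 : bounded_sidon set0 by split=> //; exists 0%N.
pose S := fix S k := if k is k'.+1 then f (S k', k') else exist bounded_sidon set0 b0.
have mono i j : (i <= j)%N -> sval (S i) `<=` sval (S j).
  move=> /subnKC <-; elim: (j - i)%N => [|m IH]; first by rewrite addn0.
  rewrite addnS; apply: subset_trans IH _.
  by case: (hf (S (i + m)%N, (i + m)%N)).
pose A := \bigcup_k sval (S k).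
have SA k : sval (S k) `<=` A by move=> x Sx; exists k.
exists A; split.
- move=> a b c d [i _ ha] [j _ hb] [k _ hc] [l _ hd].
  pose m := (i + j + k + l)%N.
  apply: (svalP (S m)).1; by [apply: (mono _ _ _ _ ha); rewrite /m; lia
    |apply: (mono _ _ _ _ hb); rewrite /m; lia|apply: (mono _ _ _ _ hc); rewrite /m; lia
    |apply: (mono _ _ _ _ hd); rewrite /m; lia].
- move=> n; case: (hf (S (pickle n), pickle n)) => _ _ [a [b [ha hb]]].
  rewrite /= pickleK /= => ->; exists a, b.
  by split=> //; apply: (SA (pickle n).+1).
- by move=> k; case: (hf (S k, k)) => _ + _; apply: dense_atS; exact: (SA k.+1).
Qed.

Lemma sidon_unique_rep_basis (A : set int) : sidon A ->
  (forall n, exists a b, [/\ A a, A b & n = a + b]) -> unique_rep_basis A.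
Proof.
move=> sA hA n; have [a [b [Aa Ab nE]]] := hA n.
wlog ab : a b Aa Ab nE / a <= b.
  move=> W; case: (leP a b) => [|/ltW] h;
    by [apply: (W a b)|apply: (W b a) => //; rewrite addrC].
suff -> : reps A n = [set (a, b)] by exact: card_set1.
apply/seteqP; split=> [[c d] [/= Ac Ad cd e]|_ ->]; last by split.
have /(sA _ _ _ _ Ac Ad Aa Ab) : c + d = a + b by rewrite -e.
case=> -[cE dE]; first by rewrite cE dE.
by congr (_, _); lia.
Qed.

(** * Lower bounds for the counting function and its upper limit *)

Lemma counting_fun_ge (R : realType) (A : set int) (x : nat) (s : seq int) :
  uniq s -> (forall a, a \in s -> A a /\ `|a| <= x%:Z) ->
  (size s <= counting_fun A (x%:R : R))%N.
Proof.
move=> us hs; apply: uniq_leq_size => // a /hs[Aa ax].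
have xE (c : int) : (- (x%:R : R) <= c%:~R <= (x%:R : R)) = (`|c| <= x%:Z).
  have -> : x%:R = x%:Z%:~R :> R by [].
  by rewrite -mulrNz !ler_int ler_norml.
(* Finiteness rules out the default value of [fset_set]: the set lies in a translate of
   [{0, ..., 2x}]. *)
have fin : finite_set [set c : int | A c /\ (- (x%:R : R) <= c%:~R <= (x%:R : R))].
  apply: (@sub_finite_set _ _ [set (i%:Z - x%:Z) | i in `I_(2 * x).+1]).
    by move=> c [_]; rewrite xE => hc; exists (absz (c + x%:Z)) => /=; lia.
  exact/finite_image/finite_II.
suff : a \in [set c : int | A c /\ (- (x%:R : R) <= c%:~R <= (x%:R : R))].
  by rewrite -(in_fset_set fin).
by rewrite inE /= xE.
Qed.

Lemma dense_at_counting_fun (R : realType) (A : set int) (k : nat) : dense_at A k ->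
  exists2 x : nat, (0 < x)%N && (k <= x)%N &
    k%:R / k.+1%:R <= (counting_fun A (x%:R : R))%:R / Num.sqrt x%:R :> R.
Proof.
move=> [x [p [s [x0 /andP[kx xp] kp us hs]]]]; exists x; first by rewrite x0.
have sx0 : 0 < Num.sqrt x%:R :> R by rewrite sqrtr_gt0 ltr0n.
have sxp : Num.sqrt x%:R <= p%:R :> R.
  rewrite -[leRHS]ger0_norm // -sqrtr_sqr ler_wsqrtr // -natrX.
  by rewrite ler_nat.
rewrite ler_pdivlMr // mulrAC ler_pdivrMr //.
apply: (@le_trans _ _ (k%:R * p%:R)); first by rewrite ler_wpM2l.
rewrite -!natrM ler_nat (leq_trans kp) // mulnC leq_mul2r.
by rewrite counting_fun_ge ?orbT.
Qed.

Lemma dense_at_c_of_ge1 (R : realType) (A : set int) : (forall k, dense_at A k) ->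
  (1 <= c_of R A)%E.
Proof.
move=> hA; apply: le_ereal_inf_tmp => _ [V [M [_ MV]] <-].
apply/lee_addgt0Pr => e e0.
(* This [k] is large enough that [x >= k] lies in the neighbourhood [V] of infinity and that
   [1 / (k + 1) <= e]. *)
pose k := (Num.truncn (`|M| + e^-1)).+1.
have kb : `|M| + e^-1 < k%:R by rewrite /k truncnS_gt.
have e'0 : 0 < e^-1 by rewrite invr_gt0.
have [x /andP[x0 kx] hx] := dense_at_counting_fun R (hA k).
have Mx : M < x%:R.
  have : k%:R <= x%:R :> R by rewrite ler_nat.
  have := ler_norm M; lra.
apply: (@le_trans _ _ ((k%:R / k.+1%:R) + e)%:E).
  rewrite lee_fin -[leLHS](@divff _ (k.+1%:R : R)) // {1}mulrSr mulrDl lerD2l mul1r.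
  rewrite -[leRHS]invrK lef_pV2 ?posrE // -natr1.
  have := normr_ge0 M; lra.
rewrite EFinD leeD2r //.
apply: (@le_trans _ _ ((counting_fun A (x%:R : R))%:R / Num.sqrt x%:R)%:E).
  by rewrite lee_fin.
by apply: ereal_sup_ubound; exists x%:R => //; exact: MV.
Qed.

Lemma dense_at_dense_unique_rep_bases (R : realType) (A : set int) :
  unique_rep_basis A -> (forall k, dense_at A k) -> dense_unique_rep_bases R A.
Proof.
move=> uA hA; split=> //; exists 2^-1 => //.
move=> /finite_seqP[t tE].
pose n := (\max_(i <- t) i)%N.
(* Taking [k = n + 2] puts [x] beyond the supposedly complete list [t], and [k >= 2] makes
   [k / (k + 1)] strictly larger than [1/2]. *)
have [x /andP[x0 kx] hx] := dense_at_counting_fun R (hA (n + 2)%N).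
suff : x \in t by move=> /(@leq_bigmax_seq _ _ xpredT id)/(_ isT); rewrite -/n; lia.
suff : [set` t] x by [].
rewrite -tE /=; split=> //.
rewrite -ltr_pdivlMr ?sqrtr_gt0 ?ltr0n //; apply: lt_le_trans hx.
rewrite ltr_pdivlMr // -[X in _ * X]natr1 natrD.
by have := ler0n R n; lra.
Qed.

Theorem theorem1 (R : realType) : (1 <= c_sup R)%E.
Proof.
have [A [sA hA dA]] := exists_dense_sidon_basis.
apply: le_trans (dense_at_c_of_ge1 R dA) _.
apply: ereal_sup_ubound; exists A => //.
by apply: dense_at_dense_unique_rep_bases => //; exact: sidon_unique_rep_basis.
Qed.
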